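(* In the setting of the context, suppose the regularity assumption and the local worst-case oracle assumption hold, and fix $x\in\mathcal X$ (write $\ell_k(z)=\ell_k(x,z)$). Then for each $i\in[N]$ the function $b\mapsto V_i(b)$ is concave on $\mathbb R_+$, where $V_i(b)=\max_{1\le k_1<k_2\le K}V_i^{(k_1,k_2)}(b)$ is the local utility defined in the context.
   Context: Notation: $[n]=\{1,\dots,n\}$; $\mathcal P(\mathcal Z)$ is the set of Borel probability measures on $\mathcal Z$. Setting. $\mathcal X\subseteq\mathbb R^n$, $\mathcal Z\subseteq\mathbb R^m$. A transportation cost $c:\mathcal Z\times\mathcal Z\to\mathbb R_+$ is lower semicontinuous, satisfies $c(z,z)=0$ for all $z$, and $c(\cdot,\hat z)$ is convex for every fixed $\hat z\in\mathcal Z$. The optimal transport discrepancy is $\mathrm{OT}_c(\mathbb P,\mathbb Q)=\min_{\gamma}\mathbb E_{(z,\hat z)\sim\gamma}[c(z,\hat z)]$ over couplings $\gamma$ of $\mathbb P$ and $\mathbb Q$. Given $\hat z_1,\dots,\hat z_N\in\mathcal Z$, let $\hat{\mathbb P}=\frac1N\sum_{i=1}^N\delta_{\hat z_i}$; given $\rho>0$, let $\mathcal P=\{\mathbb P\in\mathcal P(\mathcal Z):\mathrm{OT}_c(\mathbb P,\hat{\mathbb P})\le\rho\}$. Regularity assumption. (i) $\mathcal X$ is nonempty and convex; there exist $\mathbb Q_0\in\mathcal P$ and $x_0\in\mathcal X$ such that $x\mapsto\mathbb E_{z\sim\mathbb Q_0}[\ell(x,z)]$ is inf-compact on $\mathcal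 X$ (all sublevel sets are compact) and $\mathbb E_{z\sim\mathbb Q_0}[\ell(x_0,z)]>-\infty$; $\mathcal Z$ is nonempty, closed and convex. (ii) $\ell(x,z)=\max_{k\in[K]}\ell_k(x,z)$ with $K\ge2$, where each $\ell_k:\mathbb R^n\times\mathbb R^m\to\mathbb R$ is real-valued, convex in its first and concave in its second argument. (iii) There exist a norm $\|\cdot\|$ on $\mathbb R^m$ and $p\ge1$ with $c(z,\hat z)\ge\|z-\hat z\|^p$ for all $z,\hat z\in\mathcal Z$; moreover, if $p=1$, then for every $x\in\mathcal X$ there exist $g>0$, $\hat z_0\in\mathcal Z$ and $r\in[0,1)$ such that $\ell(x,z)\le g[1+\|z-\hat z_0\|^r]$ for all $z\in\mathcal Z$. Local worst-case oracle assumption. For any $k\in[K]$, $\hat z\in\mathcal Z$, radius $u\ge0$ and accuracy $\epsilon>0$ there is an algorithm that returns $\hat v\in\mathbb R^m$ with $\hat z+\hat v\in\mathcal Z$, $c(\hat z+\hat v,\hat z)\le u$, together with $\hat L=\ell_k(\hat z+\hat v)\ge\max\{\ell_k(\hat z+v):v\in\mathbb R^m,\hat z+v\in\mathcal Z,c(\hat z+v,\hat z)\le u\}-\epsilon$. Local utilities. $V_i^{(k_1,k_2)}(b)$ is the maximum of $\alpha_1\ell_{k_1}(\hat z_i+v_1)+\alpha_2\ell_{k_2}(\hat z_i+v_2)$ over $\alpha_j,\beta_j\in\mathbb R_+$, $v_j\in\mathbb R^m$ with $\hat z_i+v_j\in\mathcal Z$, $\alpha_jc(\hat z_i+v_j,\hat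 z_i)\le\beta_j$ ($j=1,2$), $\alpha_1+\alpha_2=1$, $\beta_1+\beta_2=b$. *)

(* Defs.v *)
From HB Require Import structures.
From mathcomp Require Import all_boot all_order all_algebra.
From mathcomp Require Import all_classical all_reals all_analysis.

Set Implicit Arguments.
Unset Strict Implicit.
Unset Printing Implicit Defensive.

Import Order.TTheory GRing.Theory Num.Theory.
Import numFieldNormedType.Exports.

Local Open Scope classical_set_scope.
Local Open Scope ring_scope.

Notation borelV R m := (g_sigma_algebraType (@open 'rV[R]_m)).

Definition is_norm (R : realType) (m : nat) (nrm : 'rV[R]_m -> R) : Prop :=
  [/\ forall v, nrm v = 0 -> v = 0,
      forall a v, nrm (a *: v) = `|a| * nrm v
    & forall v w, nrm (v + w) <= nrm v + nrm w].

(* [c] is only meaningful on [Z `*` Z].  In [subspace A], the points outside A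
   are isolated, so [tc_lsc] is lower semicontinuity relative to Z x Z. *)
Record transport_cost (R : realType) (m : nat) (Z : set 'rV[R]_m)
    (c : 'rV[R]_m -> 'rV[R]_m -> R) : Prop := TransportCost {
  tc_ge0 : forall z zh, Z z -> Z zh -> 0 <= c z zh ;
  tc_lsc : lower_semicontinuous
    (fun w : subspace (Z `*` Z) => (c w.1 w.2)%:E) ;
  tc_diag : forall z, Z z -> c z z = 0 ;
  tc_convex : forall zh, Z zh -> convex_function Z (c^~ zh) }.

Section OptimalTransport.
Variables (R : realType) (m : nat).
Variables (Z : set 'rV[R]_m) (c : 'rV[R]_m -> 'rV[R]_m -> R).

Definition coupling (P Q : set (borelV R m) -> \bar R)
    (gamma : probability (borelV R m * borelV R m)%type R) : Prop :=
  forall A : set (borelV R m), measurable A ->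
    pushforward gamma fst A = P A /\ pushforward gamma snd A = Q A.

(* Couplings of measures concentrated on Z are concentrated on Z x Z, so
   integrating over Z x Z is integrating over the whole space. *)
Definition OT (P Q : set (borelV R m) -> \bar R) : \bar R :=
  ereal_inf [set (\int[gamma]_(w in Z `*` Z) (c w.1 w.2)%:E)%E
            | gamma in coupling P Q].

Definition empirical (N : nat) (zhat : 'I_N -> 'rV[R]_m)
    (A : set (borelV R m)) : \bar R :=
  ((N%:R^-1)%:E * \sum_(i < N) \d_(zhat i : borelV R m) A)%E.

(* A Borel probability measure on Z is represented by a Borel probability
   measure on R^m that gives mass 1 to Z. *)
Definition ambiguity_set (N : nat) (zhat : 'I_N -> 'rV[R]_m) (rho : R) :
    set (probability (borelV R m) R) :=
  [set P | P Z = 1%E /\ (OT P (empirical zhat) <= rho%:E)%E].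

End OptimalTransport.

(* Extended-real valued only so that the maximum has a neutral element; it is
   finite as soon as K > 0. *)
Definition loss (R : realType) (n m K : nat)
    (lk : 'I_K -> 'rV[R]_n -> 'rV[R]_m -> R)
    (x : 'rV[R]_n) (z : 'rV[R]_m) : \bar R :=
  \big[maxe/-oo%E]_(k < K) (lk k x z)%:E.

Definition expected_loss (R : realType) (n m K : nat) (Z : set 'rV[R]_m)
    (lk : 'I_K -> 'rV[R]_n -> 'rV[R]_m -> R)
    (Q : probability (borelV R m) R) (x : 'rV[R]_n) : \bar R :=
  (\int[Q]_(z in Z) loss lk x z)%E.

Definition inf_compact_on (R : realType) (n : nat) (X : set 'rV[R]_n)
    (f : 'rV[R]_n -> \bar R) : Prop :=
  forall a : R, compact [set x | X x /\ (f x <= a%:E)%E].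

Definition growth_condition (R : realType) (n m K : nat)
    (X : set 'rV[R]_n) (Z : set 'rV[R]_m)
    (c : 'rV[R]_m -> 'rV[R]_m -> R)
    (lk : 'I_K -> 'rV[R]_n -> 'rV[R]_m -> R) : Prop :=
  exists (nrm : 'rV[R]_m -> R) (p : R),
    [/\ is_norm nrm, 1 <= p,
        forall z zh, Z z -> Z zh -> nrm (z - zh) `^ p <= c z zh
      & p = 1 -> forall x, X x ->
        exists (g : R) (z0 : 'rV[R]_m) (r : R),
          [/\ 0 < g, Z z0, 0 <= r < 1
            & forall z, Z z ->
                (loss lk x z <= (g * (1 + nrm (z - z0) `^ r))%:E)%E]].

Record regularity (R : realType) (n m K N : nat)
    (X : set 'rV[R]_n) (Z : set 'rV[R]_m)
    (c : 'rV[R]_m -> 'rV[R]_m -> R)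
    (zhat : 'I_N -> 'rV[R]_m) (rho : R)
    (lk : 'I_K -> 'rV[R]_n -> 'rV[R]_m -> R) : Prop := Regularity {
  reg_X_neq0 : X !=set0 ;
  reg_X_convex : convex_set X ;
  reg_inf_compact : exists (Q0 : probability (borelV R m) R) (x0 : 'rV[R]_n),
    [/\ ambiguity_set Z c zhat rho Q0, X x0,
        inf_compact_on X (expected_loss Z lk Q0)
      & (-oo < expected_loss Z lk Q0 x0)%E] ;
  reg_Z_neq0 : Z !=set0 ;
  reg_Z_closed : closed Z ;
  reg_Z_convex : convex_set Z ;
  reg_K_ge2 : (2 <= K)%N ;
  reg_lk_convex : forall k z, convex_function setT (fun x => lk k x z) ;
  reg_lk_concave : forall k x, convex_function setT (fun z => - lk k x z) ;
  reg_growth : growth_condition X Z c lk }.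

(* The algorithm is a map from inputs (k, zh, u, eps) to outputs (vh, Lh). *)
Definition local_worst_case_oracle (R : realType) (m K : nat)
    (Z : set 'rV[R]_m) (c : 'rV[R]_m -> 'rV[R]_m -> R)
    (l : 'I_K -> 'rV[R]_m -> R) : Prop :=
  exists oracle : 'I_K -> 'rV[R]_m -> R -> R -> 'rV[R]_m * R,
    forall k zh u eps, Z zh -> 0 <= u -> 0 < eps ->
      let: (vh, Lh) := oracle k zh u eps in
      [/\ Z (zh + vh), c (zh + vh) zh <= u, Lh = l k (zh + vh)
        & (ereal_sup [set (l k (zh + v))%:E
                     | v in [set v | Z (zh + v) /\ c (zh + v) zh <= u]%R]
           - eps%:E <= Lh%:E)%E].

Section LocalUtility.
Variables (R : realType) (m K : nat).
Variables (Z : set 'rV[R]_m) (c : 'rV[R]_m -> 'rV[R]_m -> R).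
Variables (l : 'I_K -> 'rV[R]_m -> R) (zi : 'rV[R]_m).

Definition local_utility2 (k1 k2 : 'I_K) (b : R) : \bar R :=
  ereal_sup [set y : \bar R |
    exists (a1 a2 b1 b2 : R) (v1 v2 : 'rV[R]_m),
      [/\ [/\ 0 <= a1, 0 <= a2, 0 <= b1 & 0 <= b2],
          Z (zi + v1) /\ Z (zi + v2),
          a1 * c (zi + v1) zi <= b1 /\ a2 * c (zi + v2) zi <= b2,
          a1 + a2 = 1 /\ b1 + b2 = b
        & y = (a1 * l k1 (zi + v1) + a2 * l k2 (zi + v2))%:E]].

Definition local_utility (b : R) : \bar R :=
  \big[maxe/-oo%E]_(k : 'I_K * 'I_K | (k.1 < k.2)%N)
    local_utility2 k.1 k.2 b.

End LocalUtility.

Definition concave_on (R : realType) (D : set R) (f : R -> \bar R) : Prop :=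
  forall a b t : R, D a -> D b -> 0 <= t <= 1 ->
    (t%:E * f a + (1 - t)%:E * f b <= f (t * a + (1 - t) * b)%R)%E.

(* Main.v *)
Require Import Defs.
From HB Require Import structures.
From mathcomp Require Import all_boot all_order all_algebra.
From mathcomp Require Import all_classical all_reals all_analysis.
From mathcomp Require Import ring lra.

Set Implicit Arguments.
Unset Strict Implicit.
Unset Printing Implicit Defensive.

Import Order.TTheory GRing.Theory Num.Theory.
Import numFieldNormedType.Exports.

Local Open Scope classical_set_scope.
Local Open Scope ring_scope.

(** Up to the order of the pieces and the way the budget is split, a feasible
    point for [V_i(b)] is a mixture of at most two atoms [(k, z)] with average
    transport cost at most [b], its value being the average of [l_k(z)].
    Averaging near-optimal points for [V_i(a)] and [V_i(b)] gives a mixture of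
    four atoms.  A mixture is constrained only by its total mass and its average
    cost, so by Caratheodory's argument two of the atoms suffice to reach the
    same value.  If these two atoms carry the same piece [k], concavity of
    [l_k] and convexity of [c] merge them into a single one. *)

(** * Caratheodory reduction of finite weights under two linear constraints *)

Section Caratheodory.
Context {R : realFieldType} {I : finType}.
Implicit Types (w d u y : I -> R).

Lemma sum_three_deltas (i1 i2 i3 : I) (a1 a2 a3 : R) (f : I -> R) :
  \sum_i (a1 * (i == i1)%:R + a2 * (i == i2)%:R + a3 * (i == i3)%:R) * f i
  = a1 * f i1 + a2 * f i2 + a3 * f i3.
Proof.
have delta a j : \sum_i a * (i == j)%:R * f i = a * f j.
  rewrite (bigD1 j)//= eqxx mulr1 big1 ?addr0// => i /negPf ->.
  by rewrite mulr0 mul0r.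
rewrite -!delta -!big_split /=; apply: eq_bigr => i _.
by rewrite !mulrDl.
Qed.

(* The direction is the kernel of the map sending a weight on the three points
   to its mass and first moment, given by the cross product of
   [(1, 1, 1)] and [(u i1, u i2, u i3)] unless [u i1 = u i2]. *)
Lemma exists_improving_direction u y {A : {pred I}} : (2 < #|A|)%N ->
  exists d, [/\ forall i, i \notin A -> d i = 0, exists i, d i < 0,
    \sum_i d i = 0, \sum_i d i * u i = 0 & 0 <= \sum_i d i * y i].
Proof.
case/card_gt2P => i1 [i2 [i3 [[A1 A2 A3] [n12 n23 n31]]]].
have [d [dA [j dj] d0 du]] : exists d,
    [/\ forall i, i \notin A -> d i = 0, exists i, d i != 0,
      \sum_i d i = 0 & \sum_i d i * u i = 0].
  pose e a1 a2 a3 i : R :=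
    a1 * (i == i1)%:R + a2 * (i == i2)%:R + a3 * (i == i3)%:R.
  have eA a1 a2 a3 i : i \notin A -> e a1 a2 a3 i = 0.
    rewrite /e => iA.
    have ne j : j \in A -> (i == j) = false.
      by move=> jA; apply: contraNF iA => /eqP ->.
    by rewrite !ne// !mulr0 !addr0.
  have e0 a1 a2 a3 : a1 + a2 + a3 = 0 -> \sum_i e a1 a2 a3 i = 0.
    move=> a0; have := sum_three_deltas i1 i2 i3 a1 a2 a3 (fun=> 1).
    by rewrite !mulr1 a0; under eq_bigr do rewrite mulr1.
  have [u12|u12] := eqVneq (u i1) (u i2).
    exists (e 1 (- 1) 0); split => //; first exact: eA.
    - exists i1; rewrite /e eqxx (negPf n12) [i1 == i3]eq_sym (negPf n31).
      by rewrite mulr1 !mulr0 !addr0 oner_eq0.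
    - by apply: e0; ring.
    - by rewrite sum_three_deltas u12; ring.
  exists (e (u i2 - u i3) (u i3 - u i1) (u i1 - u i2)); split => //.
  - exact: eA.
  - exists i3; rewrite /e eqxx (negPf n31) [i3 == i2]eq_sym (negPf n23).
    by rewrite !mulr0 mulr1 !add0r subr_eq0.
  - by apply: e0; ring.
  - by rewrite sum_three_deltas; ring.
(* The conditions obtained so far are invariant under [d] to [- d], so the sign of the [y]-sum can
   be chosen. *)
wlog dy : d dA dj d0 du / 0 <= \sum_i d i * y i => [hw|].
  have [/hw|dy] := leP 0 (\sum_i d i * y i); first exact.
  have sN (f : I -> R) : \sum_i - d i * f i = - \sum_i d i * f i.
    by rewrite -sumrN; apply: eq_bigr => i _; rewrite mulNr.
  apply: (hw (fun i => - d i)).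
  - by move=> i /dA ->; rewrite oppr0.
  - by rewrite oppr_eq0.
  - by rewrite sumrN d0 oppr0.
  - by rewrite sN du oppr0.
  - by rewrite sN oppr_ge0 ltW.
exists d; split => //.
(* Without a negative entry, the zero sum would force every entry to vanish, contradicting [dj]. *)
have [/existsP//|/existsPn dge0] := boolP [exists i, d i < 0].
have d_ge0 i : xpredT i -> 0 <= d i by rewrite leNgt dge0.
by have /eqP := psumr_eq0P d_ge0 d0 (erefl : xpredT j); rewrite (negPf dj).
Qed.

(** This is the ratio test of the simplex method: among the decreasing coordinates, the smallest
    ratio [w i / - d i] is the first time at which a weight reaches zero. *)
Lemma exists_maximal_step w d : (forall i, 0 <= w i) -> (exists i, d i < 0) ->
  exists2 t : R, 0 <= t & (forall i, 0 <= w i + t * d i) /\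
    exists2 i, d i < 0 & w i + t * d i = 0.
Proof.
move=> w0 [j dj].
pose r i := w i / - d i.
case: (arg_minP (P := fun i => d i < 0) r dj) => i di imin.
have r0 : 0 <= r i by rewrite divr_ge0// oppr_ge0 ltW.
exists (r i) => //; split=> [k|]; last first.
  by exists i => //; rewrite /r; field; rewrite lt_eqF.
have [dk|dk] := ltP (d k) 0; last by rewrite addr_ge0// mulr_ge0.
have := imin k dk; rewrite {2}/r ler_pdivlMr ?oppr_gt0//.
by rewrite mulrN -subr_ge0 opprK.
Qed.

(** Induction on the size of the support: while it exceeds two, a maximal step along an improving
    direction removes a point without lowering the [y]-sum. *)
Lemma caratheodory_support_le2 u y w : (forall i, 0 <= w i) ->
  exists w', [/\ forall i, 0 <= w' i,
    (#|[pred i | w' i != 0%R]| <= 2)%N, \sum_i w' i = \sum_i w i,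
    \sum_i w' i * u i = \sum_i w i * u i
    & \sum_i w i * y i <= \sum_i w' i * y i].
Proof.
have [N] := ubnP #|[pred i | w i != 0]|.
elim: N w => // N IH w wN w0.
have [|w2] := leqP #|[pred i | w i != 0]| 2; first by exists w.
have [d [dA dneg d0 du dy]] := exists_improving_direction u y w2.
have [t t0 [wt [i di wi]]] := exists_maximal_step w0 dneg.
have sE (f : I -> R) : \sum_i (w i + t * d i) * f i =
    \sum_i w i * f i + t * \sum_i d i * f i.
  by rewrite mulr_sumr -big_split; apply: eq_bigr => k _ /=; ring.
have [||w' [w'0 w'2 sw' su' sy']] := IH (fun i => w i + t * d i).
(* The support shrinks strictly: [d] vanishes off it, so no point enters, and [i] leaves, having
   belonged to it because [d i < 0]. *)
- rewrite (leq_trans _ (_ : #|[pred i | w i != 0%R]| <= N)%N)//.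
  apply/proper_card/properP; split.
    apply/fintype.subsetP => k; rewrite !inE; apply: contra => /eqP wk.
    by rewrite wk dA ?mulr0 ?addr0// inE wk eqxx.
  exists i; rewrite !inE ?wi ?eqxx//.
  by apply: contraTneq di => iw; rewrite dA ?ltxx// inE iw eqxx.
- exact: wt.
exists w'; split => //.
- by rewrite sw' big_split/= -mulr_sumr d0 mulr0 addr0.
- by rewrite su' sE du mulr0 addr0.
- by apply: le_trans sy'; rewrite sE lerDl mulr_ge0.
Qed.

Lemma caratheodory_two_points u y w :
  (forall i, 0 <= w i) -> \sum_i w i = 1 ->
  exists i j (s t : R), [/\ 0 <= s, 0 <= t, s + t = 1,
    s * u i + t * u j = \sum_i w i * u i
    & \sum_i w i * y i <= s * y i + t * y j].
Proof.
move=> w0 w1; have [w' [w'0 w'2 sw' su' sy']] := caratheodory_support_le2 u y w0.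
have [i wi] : exists i, w' i != 0.
  apply/existsP; apply: contra_eqT w1 => /existsPn w'E.
  rewrite -sw' big1 ?(eq_sym 0) ?oner_eq0// => i _.
  by apply/eqP; have := w'E i; rewrite negbK.
have sumE j : (forall k, k != i -> k != j -> w' k = 0) ->
    exists2 t : R, 0 <= t & forall f : I -> R,
      \sum_k w' k * f k = w' i * f i + t * f j.
  move=> w'E; exists (if j == i then 0 else w' j) => [|f]; first by case: ifP.
  rewrite (bigD1 i)//=; congr (_ + _); have [ji|ji] := eqVneq j i.
    by rewrite mul0r big1// => k ki; rewrite w'E ?mul0r// ji.
  by rewrite (bigD1 j)//= big1 ?addr0// => k /andP[ki kj]; rewrite w'E ?mul0r.
have [j /sumE[t t0 sE]] : exists j, forall k, k != i -> k != j -> w' k = 0.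
  have [/existsP[j /andP[ji wj]]|/existsPn w'E] :=
    boolP [exists j, (j != i) && (w' j != 0)].
    exists j => k ki kj; apply/eqP; apply: contraTT w'2 => wk; rewrite -ltnNge.
    by apply/card_gt2P; exists i, j, k; rewrite !inE wi wj wk eq_sym ji eq_sym.
  exists i => k ki _; apply/eqP; have := w'E k.
  by rewrite ki /= negbK.
exists i, j, (w' i), t; split => //.
- have := sE (fun=> 1); under eq_bigr do rewrite mulr1.
  by rewrite sw' w1 !mulr1.
- by rewrite -sE.
- by rewrite -sE.
Qed.

End Caratheodory.

(** * Convex combinations with explicit weights, and suprema of weighted sums *)

Section ConvexCombinations.
Context {R : realType} {E : lmodType R}.
Implicit Types (D : set E) (s t : R) (x y : E).

Lemma convex_set_comb D s t x y : convex_set D -> D x -> D y ->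
  0 <= s -> 0 <= t -> s + t = 1 -> D (s *: x + t *: y).
Proof.
move=> cD Dx Dy s0 t0 st1.
have s1 : s <= 1 by rewrite -st1 lerDl.
have := cD x y (Itv01 s0 s1) (mem_set Dx) (mem_set Dy).
by move/set_mem; rewrite /conv /= /unstable.onem (_ : 1 - s = t)// -st1; ring.
Qed.

Lemma convex_function_comb D (f : E -> R) s t x y :
  convex_function D f -> D x -> D y ->
  0 <= s -> 0 <= t -> s + t = 1 ->
  f (s *: x + t *: y) <= s * f x + t * f y.
Proof.
move=> cf Dx Dy s0 t0 st1.
have s1 : s <= 1 by rewrite -st1 lerDl.
have := cf (Itv01 s0 s1) x y (mem_set Dx) (mem_set Dy).
by rewrite convRE /conv /= /unstable.onem (_ : 1 - s = t)// -st1; ring.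
Qed.

End ConvexCombinations.

(** For fixed [y], dividing by [s] bounds the supremum of [A]; this bound then yields one on the
    supremum of [B] after division by [t]. Nonemptiness excludes [-oo], so when [M] is real both
    suprema are real. *)
Lemma ereal_sup_comb_le {R : realType} (A B : set R) (s t : R) (M : \bar R) :
  A !=set0 -> B !=set0 -> 0 < s -> 0 < t ->
  (forall x y, A x -> B y -> ((s * x + t * y)%:E <= M)%E) ->
  (s%:E * ereal_sup (EFin @` A) + t%:E * ereal_sup (EFin @` B) <= M)%E.
Proof.
move=> [x0 Ax0] [y0 By0] s0 t0; case: M => [r| |] AB; first last.
- by have := AB _ _ Ax0 By0.
- exact: leey.
have ubA y : B y -> (ereal_sup (EFin @` A) <= ((r - t * y) / s)%:E)%E.
  move=> By; apply: ge_ereal_sup => _ [x Ax <-].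
  by rewrite lee_fin ler_pdivlMr// mulrC lerBrDr -lee_fin AB.
have lbA : (x0%:E <= ereal_sup (EFin @` A))%E.
  by apply: ereal_sup_ubound; exists x0.
case: (ereal_sup _) ubA lbA => [a| |] ubA lbA; first last.
- by [].
- by have := ubA _ By0.
have ubB : (ereal_sup (EFin @` B) <= ((r - s * a) / t)%:E)%E.
  apply: ge_ereal_sup => _ [y By <-].
  rewrite lee_fin ler_pdivlMr//; have := ubA _ By.
  by rewrite lee_fin ler_pdivlMr//; lra.
have lbB : (y0%:E <= ereal_sup (EFin @` B))%E.
  by apply: ereal_sup_ubound; exists y0.
case: (ereal_sup _) ubB lbB => [b| |]// + _.
by rewrite -!EFinM -EFinD !lee_fin ler_pdivlMr//; lra.
Qed.

(** * Local utilities as suprema over mixtures *)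

Section LocalUtilityMixtures.
Context {R : realType} {m K : nat}.
Variables (Z : set 'rV[R]_m) (c : 'rV[R]_m -> 'rV[R]_m -> R).
Variables (l : 'I_K -> 'rV[R]_m -> R) (zi : 'rV[R]_m).

Local Notation V := (local_utility Z c l zi).

Definition mixture_values (b : R) : set R := [set y : R |
  exists (w : bool -> R) (k : bool -> 'I_K) (z : bool -> 'rV[R]_m),
    [/\ forall j, 0 <= w j, w true + w false = 1, forall j, Z (z j),
        w true * c (z true) zi + w false * c (z false) zi <= b
      & y = w true * l (k true) (z true) + w false * l (k false) (z false)]].

Lemma local_utility_le_sup_mixture b :
  (V b <= ereal_sup (EFin @` mixture_values b))%E.
Proof.
apply: bigmax_le => [|[k1 k2] _]; first exact: leNye.
apply: ge_ereal_sup => y [a1 [a2 [b1 [b2 [v1 [v2]]]]]].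
move=> [[a10 a20 _ _] [Z1 Z2] [c1 c2] [a12 b12] ->].
apply: ereal_sup_ubound; eexists; last by [].
exists (fun j => if j then a1 else a2), (fun j => if j then k1 else k2),
  (fun j => zi + if j then v1 else v2); split => //; try by case.
by rewrite -b12 lerD.
Qed.

Hypothesis c_ge0 : forall z, Z z -> 0 <= c z zi.

Lemma distinct_mixture_le_local_utility (a1 a2 b : R) (k1 k2 : 'I_K) z1 z2 :
  k1 != k2 -> 0 <= a1 -> 0 <= a2 -> a1 + a2 = 1 -> Z z1 -> Z z2 ->
  a1 * c z1 zi + a2 * c z2 zi <= b ->
  ((a1 * l k1 z1 + a2 * l k2 z2)%:E <= V b)%E.
Proof.
wlog k12 : a1 a2 k1 k2 z1 z2 / (k1 < k2)%N => [hw kn a10 a20 a12 Z1 Z2 cb|_].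
  have : (k1 < k2)%N || (k2 < k1)%N by rewrite -neq_ltn.
  case/orP => [k12|k21]; first exact: hw.
  by rewrite addrC; apply: hw => //; rewrite 1?eq_sym// addrC.
move=> a10 a20 a12 Z1 Z2 cb.
apply: le_trans (le_bigmax_cond _
  (fun k : 'I_K * 'I_K => local_utility2 Z c l zi k.1 k.2 b)
  (j := (k1, k2)) k12).
apply: ereal_sup_ubound.
(* The first atom receives exactly its cost as budget, the second all the rest. *)
exists a1, a2, (a1 * c z1 zi), (b - a1 * c z1 zi), (z1 - zi), (z2 - zi).
have a1c : 0 <= a1 * c z1 zi by rewrite mulr_ge0// c_ge0.
have a2c : 0 <= a2 * c z2 zi by rewrite mulr_ge0// c_ge0.
by rewrite !(addrC zi) !subrK; split => //; split => //; lra.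
Qed.

Hypothesis Z_convex : convex_set Z.
Hypothesis c_convex : convex_function Z (c^~ zi).
Hypothesis l_concave : forall k, convex_function setT (fun z => - l k z).
Hypothesis K_ge2 : (2 <= K)%N.

Lemma mixture_le_local_utility (a1 a2 b : R) (k1 k2 : 'I_K) z1 z2 :
  0 <= a1 -> 0 <= a2 -> a1 + a2 = 1 -> Z z1 -> Z z2 ->
  a1 * c z1 zi + a2 * c z2 zi <= b ->
  ((a1 * l k1 z1 + a2 * l k2 z2)%:E <= V b)%E.
Proof.
move=> a10 a20 a12 Z1 Z2 cb.
have [<-|k12] := eqVneq k1 k2; last exact: distinct_mixture_le_local_utility.
have [k k1k] : exists k : 'I_K, k1 != k.
  have /card_gt1P[j [k [_ _ jk]]] : (1 < #|'I_K|)%N by rewrite card_ord.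
  have [k1j|] := eqVneq k1 j; last by exists j.
  by exists k; rewrite k1j.
pose z := a1 *: z1 + a2 *: z2.
have Zz : Z z by exact: convex_set_comb.
have cz : c z zi <= a1 * c z1 zi + a2 * c z2 zi.
  exact: (convex_function_comb c_convex).
have lz : a1 * l k1 z1 + a2 * l k1 z2 <= l k1 z.
  have := convex_function_comb (l_concave k1) (I : setT z1) (I : setT z2) a10 a20 a12.
  by rewrite -/z; lra.
(* [V] only admits pairs of different pieces, so the merged atom is paired with another piece [k] of
   weight 0, which exists since [K] is at least 2. *)
have := @distinct_mixture_le_local_utility 1 0 b k1 k z z k1k ler01 (lexx 0).
rewrite addr0 !mul1r !mul0r !addr0 => /(_ erefl Zz Zz (le_trans cz cb)).
by apply: le_trans; rewrite lee_fin.
Qed.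

Lemma finite_mixture_le_local_utility (I : finType) (w : I -> R)
    (k : I -> 'I_K) (z : I -> 'rV[R]_m) (b : R) :
  (forall i, 0 <= w i) -> \sum_i w i = 1 -> (forall i, Z (z i)) ->
  \sum_i w i * c (z i) zi <= b ->
  ((\sum_i w i * l (k i) (z i))%:E <= V b)%E.
Proof.
move=> w0 w1 Zz cb.
have [i [j [s [t [s0 t0 st su sy]]]]] := caratheodory_two_points
  (fun i => c (z i) zi) (fun i => l (k i) (z i)) w0 w1.
apply: le_trans (_ : ((s * l (k i) (z i) + t * l (k j) (z j))%:E <= _)%E).
  by rewrite lee_fin.
by apply: mixture_le_local_utility => //; rewrite su.
Qed.

Lemma local_utility_concave : Z zi -> c zi zi = 0 ->
  concave_on [set b : R | 0 <= b] V.
Proof.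
move=> Zzi czi a b t /= a0 b0 /andP[t0 t1].
(* The endpoints are treated apart because [ereal_sup_comb_le] needs positive weights. *)
have [->|tn0] := eqVneq t 0.
  by rewrite subr0 mul0e add0e mul1e mul0r mul1r add0r.
have [->|tn1] := eqVneq t 1.
  by rewrite subrr mul0e mul1e mul0r mul1r adde0 addr0.
have tp : 0 < t by rewrite lt_neqAle eq_sym tn0.
have sp : 0 < 1 - t by rewrite subr_gt0 lt_neqAle tn1.
have mix0 (e : R) : 0 <= e -> mixture_values e !=set0.
  (* All the mass stays at [zi], where the cost is zero, so any nonnegative budget suffices. *)
  move=> e0; pose k0 := Ordinal (leq_trans (isT : 0 < 2)%N K_ge2).
  eexists; exists (fun j => j%:R), (fun=> k0), (fun=> zi).
  by split => //; rewrite ?addr0// czi !mulr0 addr0.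
apply: le_trans (ereal_sup_comb_le (mix0 a a0) (mix0 b b0) tp sp _).
  by apply: leeD; apply: lee_wpmul2l; rewrite ?lee_fin ?(ltW sp)//;
    exact: local_utility_le_sup_mixture.
move=> _ _ [w [k [z [w0 w1 Zz cw ->]]]] [w' [k' [z' [w'0 w'1 Zz' cw' ->]]]].
(* The four atoms are indexed by pairs: the first component selects the mixture, the second an atom
   in it. *)
have := @finite_mixture_le_local_utility (bool * bool)%type
  (fun i => if i.1 then t * w i.2 else (1 - t) * w' i.2)
  (fun i => if i.1 then k i.2 else k' i.2)
  (fun i => if i.1 then z i.2 else z' i.2) (t * a + (1 - t) * b).
have sumE (f : bool * bool -> R) : \sum_i f i =
    f (true, true) + f (true, false) + (f (false, true) + f (false, false)).
  rewrite (eq_bigr (fun i => f (i.1, i.2))); last by case.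
  by rewrite -(pair_bigA _ (fun i j => f (i, j)))/= !big_bool.
rewrite !sumE /=.
set x := (X in (X%:E <= _)%E) => H.
rewrite [X in (X%:E <= _)%E](_ : _ = x); last by rewrite /x; ring.
apply: H.
- by case=> [[] j]; rewrite mulr_ge0// ltW.
- by rewrite -!mulrDr w1 w'1; ring.
- by case=> -[] j /=.
- by rewrite -!mulrA -!mulrDr; apply: lerD; apply: ler_wpM2l => //; exact: ltW.
Qed.

End LocalUtilityMixtures.

Theorem lemma11 (R : realType) (n m K N : nat)
    (X : set 'rV[R]_n) (Z : set 'rV[R]_m)
    (c : 'rV[R]_m -> 'rV[R]_m -> R)
    (zhat : 'I_N -> 'rV[R]_m) (rho : R)
    (lk : 'I_K -> 'rV[R]_n -> 'rV[R]_m -> R)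
    (hc : transport_cost Z c)
    (hzhat : forall i, Z (zhat i))
    (hrho : 0 < rho)
    (hreg : regularity X Z c zhat rho lk)
    (x : 'rV[R]_n) (hx : X x)
    (horacle : local_worst_case_oracle Z c (fun k z => lk k x z))
    (i : 'I_N) :
  concave_on [set b : R | 0 <= b]
    (local_utility Z c (fun k z => lk k x z) (zhat i)).
Proof.
apply: local_utility_concave.
- by move=> z Zz; apply: (tc_ge0 hc).
- exact: (reg_Z_convex hreg).
- exact: (tc_convex hc).
- by move=> k; exact: (reg_lk_concave hreg).
- exact: (reg_K_ge2 hreg).
- exact: hzhat.
- exact: (tc_diag hc).
Qed.
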